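(* The number of $(k,3)$-top-right-crucial permutations of length $n\ge k+1$, for $k\ge3$, is given by $$s^{(tr)}_n(k,3)=\left(\frac{2k-n}{n-k}\binom{n-1}{k}\right)^2.$$ Moreover, for $2\le i\le k-1$, the number of $(k,3)$-top-right-crucial permutations of $i$-th smallest length $k+i-1$ is given by $$\left(\frac{k-i+1}{i-1}\binom{k+i-2}{k}\right)^2,$$ and this number (of $(k,3)$-top-right-crucial permutations of length $k+i-1$) is $0$ for $i\ge k$.
   Context: $i_m=12\cdots m$ and $d_m=m(m-1)\cdots 1$; a permutation (in one-line notation) contains $i_m$ (resp. $d_m$) if it has an increasing (resp. decreasing) subsequence of length $m$, and avoids it otherwise. The extensions of a permutation $\sigma=\sigma_1\cdots\sigma_n$ of $\{1,\ldots,n\}$ to the right are $e_t(\sigma_1)\cdots e_t(\sigma_n)\,t$, $1\le t\le n+1$, where $e_t(x)=x$ if $x<t$ and $e_t(x)=x+1$ if $x\ge t$. The extensions of $\sigma$ from above are $\sigma_1\cdots\sigma_{t-1}(n+1)\sigma_t\cdots\sigma_n$, $1\le t\le n+1$. A permutation is $(k,\ell)$-top-right-crucial if it avoids $i_k$ and $d_\ell$ but each of its extensions to the right and each of its extensions from above contains $i_k$ or $d_\ell$. $s^{(tr)}_n(k,\ell)$ denotes the number of $(k,\ell)$-top-right-crucial permutations of length $n$.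
   Formalization: The first formula is stated only for k+1 ≤ n ≤ 2k-2; for larger n it fails as written (k=3, n=5 gives 4 but the count is 0), and the last clause gives the count 0 for all n ≥ 2k-1. *)

(* Defs.v *)
From mathcomp Require Import all_boot all_order all_fingroup all_algebra.

Set Implicit Arguments.
Unset Strict Implicit.
Unset Printing Implicit Defensive.

(* A permutation of {1, ..., n} is an element of 'S_n, with positions and values
   both numbered from 0: the one-line notation of s is s 0, ..., s (n - 1).
   A subsequence is given by the set A of the positions it occupies. *)

Definition contains_inc (m n : nat) (s : 'S_n) : bool :=
  [exists A : {set 'I_n}, (#|A| == m) &&
    [forall x in A, forall y in A, (x < y) ==> (s x < s y)]].

Definition contains_dec (m n : nat) (s : 'S_n) : bool :=
  [exists A : {set 'I_n}, (#|A| == m) &&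
    [forall x in A, forall y in A, (x < y) ==> (s y < s x)]].

Definition contains_inc_or_dec (k l n : nat) (s : 'S_n) : bool :=
  contains_inc k s || contains_dec l s.

(* lift_perm i j s sends i to j and lift i x to lift j (s x), and lift t is the
   map e_t that fixes the values below t and increments the others. Hence the
   one-line notation below is e_t(s_1) ... e_t(s_n) t. *)
Definition extend_right (n : nat) (t : 'I_n.+1) (s : 'S_n) : 'S_n.+1 :=
  lift_perm ord_max t s.

(* The values of s are kept and the new largest value is put at position t. *)
Definition extend_above (n : nat) (t : 'I_n.+1) (s : 'S_n) : 'S_n.+1 :=
  lift_perm t ord_max s.

Definition top_right_crucial (k l n : nat) (s : 'S_n) : bool :=
  [&& ~~ contains_inc_or_dec k l s,
      [forall t, contains_inc_or_dec k l (extend_right t s)]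
    & [forall t, contains_inc_or_dec k l (extend_above t s)]].

Definition num_top_right_crucial (n k l : nat) : nat :=
  #|[set s : 'S_n | top_right_crucial k l s]|.

Definition top_right_crucial_length (k l n : nat) : bool :=
  [exists s : 'S_n, top_right_crucial k l s].

(* Counting starts at i = 1. *)
Definition ith_smallest (P : pred nat) (i n : nat) : bool :=
  P n && (count P (iota 0 n) == i.-1).

(* Main.v *)
Require Import Defs.
From mathcomp Require Import all_boot all_order all_fingroup all_algebra.
From mathcomp Require Import zify ring.

Set Implicit Arguments.
Unset Strict Implicit.
Unset Printing Implicit Defensive.

(** The proof is Robinson-Schensted insertion specialised to permutations that
    avoid d_3, whose tableaux have at most two rows.

    The insertion tableau of such a permutation s of length n is determined by
    its first row, encoded by [word s]: letter v is true when v lies in the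
    first row and false when v lies in the second.  Appending a last value t
    inserts a true letter at position t and turns the next true letter, the
    entry bumped by t, into false ([insert_at]).  Three facts make the words
    sufficient:
    - the longest increasing subsequence with values below v has as many terms
      as there are true letters before position v ([chain_inc_word]);
    - appending t creates d_3 exactly when the letters from position t on are
      not of the form 0...01...1 ([avoid_dec3_extend]);
    - a word w arises from at most two pairs (t, w'): one where nothing is
      bumped, found by removing the last true letter of w, and one where
      something is bumped, found by turning its last block 10^(i+1)1^j into
      0^i 1^(j+1) ([insert_rowE], [insert_bumpE]).
    The words that occur are the ballot words, and by induction the number of
    permutations avoiding d_3 with a given word of length n with r true letters
    is C(n,r) - C(n,r+1), whatever the word ([card_fiber]).  This is also the
    number of ballot words of length n with r true letters
    ([card_ballot_tuples]).

    Put k = r + 1.  Reading right-cruciality off the word, s is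
    (k,3)-right-crucial exactly when it avoids i_k and d_3 and some increasing
    subsequence of length r does not use the largest value
    ([right_crucialE]); taking inverses, the condition from above says that some
    increasing subsequence of length r does not use the last position.  In terms
    of words of length n + 1: the word has r true letters, ends in false, and
    arises by a bumping step ([top_right_crucialE]).  Such words are u0 with u
    a ballot word of length n, they exist only when n + 1 <= 2r, and each of
    them has a single bumping parent, of length n with r true letters.  So the
    count is (C(n,r) - C(n,r+1))^2 ([num_top_right_crucial3]), which is the
    square of the number of standard Young tableaux of shape (r, n - r). *)

(** * Monotone subsequences and the decomposition of a permutation *)

(** The points (position, value) of the subsequence are constrained by [P], so
    that bounding values and bounding positions are instances of one notion,
    exchanged by passing to the inverse. *)
Definition chain_in (b : bool) n (s : 'S_n) (m : nat) (P : rel nat) : bool :=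
  [exists A : {set 'I_n}, [&& #|A| == m, [forall x in A, P x (s x)] &
    [forall x in A, forall y in A, (x < y) ==> ((s x < s y) == b)]]].

Lemma chain_inP b n (s : 'S_n) m (P : rel nat) :
  reflect (exists A : {set 'I_n}, [/\ #|A| = m, {in A, forall x : 'I_n, P x (s x)} &
     {in A &, forall x y : 'I_n, x < y -> (s x < s y) = b}])
   (chain_in b s m P).
Proof.
apply: (iffP existsP) => [[A /and3P[/eqP cA /forall_inP hP /forall_inP hc]]|[A [cA hP hc]]].
  exists A; split=> // x y xA yA xy.
  by move: (hc x xA) => /forall_inP/(_ y yA)/implyP/(_ xy)/eqP.
exists A; apply/and3P; split; [exact/eqP|exact/forall_inP|].
by apply/forall_inP=> x xA; apply/forall_inP=> y yA; apply/implyP=> xy; apply/eqP/hc.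
Qed.

Lemma eq_chain_in b n (s : 'S_n) m (P Q : rel nat) :
  (forall x v, x < n -> v < n -> P x v = Q x v) -> chain_in b s m P = chain_in b s m Q.
Proof.
move=> eqPQ; apply: eq_existsb => A; congr [&& _, _ & _].
by apply: eq_forallb => x; rewrite eqPQ.
Qed.

Lemma chain_in0 b n (s : 'S_n) P : chain_in b s 0 P.
Proof.
by apply/chain_inP; exists set0; split=> [|x|x y]; rewrite ?cards0 ?inE.
Qed.

Lemma chain_in_S0 b (s : 'S_0) m P : chain_in b s m.+1 P = false.
Proof.
apply/chain_inP=> -[A [cA _ _]].
by have := max_card (mem A); rewrite cA card_ord.
Qed.

Lemma chain_in1 b n (s : 'S_n) t : chain_in b s 1 (fun _ v => t <= v) = (t < n).
Proof.
apply/chain_inP/idP=> [[A [/eqP/cards1P[x ->] hP _]]|lt_tn].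
  exact: leq_ltn_trans (hP x (set11 x)) (ltn_ord _).
exists [set (s^-1)%g (Ordinal lt_tn)]; split; first exact: cards1.
  by move=> x /set1P->; rewrite permKV.
by move=> x y /set1P-> /set1P->; rewrite ltnn.
Qed.

Lemma chain_inV b n (s : 'S_n) m P :
  chain_in b (s^-1)%g m P = chain_in b s m (fun x v => P v x).
Proof.
suff imp (u : 'S_n) Q : chain_in b u m Q -> chain_in b (u^-1)%g m (fun x v => Q v x).
  by apply/idP/idP=> /imp; rewrite ?invgK.
move=> /chain_inP[A [cA hQ hc]]; apply/chain_inP.
exists (u @: A); split; first by rewrite card_imset //; exact: perm_inj.
  by move=> _ /imsetP[x xA ->]; rewrite permK; apply: hQ.
move=> _ _ /imsetP[x xA ->] /imsetP[y yA ->]; rewrite !permK => uxy.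
have nxy : (x : nat) <> y by move=> /val_inj exy; rewrite exy ltnn in uxy.
by case: (ltngtP x y) nxy => // [/(hc x y xA yA)|/(hc y x yA xA)] <- _; lia.
Qed.

Lemma contains_incE m n (s : 'S_n) :
  contains_inc m s = chain_in true s m (fun _ _ => true).
Proof.
apply: eq_existsb => A; congr (_ && _).
have -> : [forall x in A, true] by apply/forall_inP.
apply: eq_forallb => x; congr (_ ==> _); apply: eq_forallb => y.
by rewrite eqb_id.
Qed.

Lemma contains_decE m n (s : 'S_n) :
  contains_dec m s = chain_in false s m (fun _ _ => true).
Proof.
apply: eq_existsb => A; congr (_ && _).
have -> : [forall x in A, true] by apply/forall_inP.
apply: eq_forallb => x; congr (_ ==> _); apply: eq_forallb => y.
congr (_ ==> _); case: (ltngtP x y) => //= ltxy.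
have nxy : (s x : nat) <> s y by move=> /val_inj/perm_inj exy; rewrite exy ltnn in ltxy.
lia.
Qed.

Lemma extend_right_lift n (t : 'I_n.+1) (s : 'S_n) (x : 'I_n) :
  extend_right t s (lift ord_max x) = lift t (s x).
Proof. exact: lift_perm_lift. Qed.

Lemma extend_right_max n (t : 'I_n.+1) (s : 'S_n) :
  extend_right t s ord_max = t.
Proof. exact: lift_perm_id. Qed.

(** Either the subsequence avoids the new last entry, or it ends there and the
    rest lies below t (increasing case) or not below t (decreasing case). *)
Lemma chain_in_extend b n (t : 'I_n.+1) (s : 'S_n) m P :
  chain_in b (extend_right t s) m.+1 P =
    chain_in b s m.+1 (fun x v => P x (bump t v)) ||
    (P n t &&
     chain_in b s m (fun x v => P x (bump t v) && ((v < t) == b))).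
Proof.
have liftmE (x : 'I_n) : lift ord_max x = x :> nat by rewrite /= /bump; have := ltn_ord x; lia.
have liftm (A : {set 'I_n.+1}) x : x \in A -> x != ord_max ->
  exists2 y, x = lift ord_max y & y \in lift ord_max @^-1: A.
  move=> xA xm; case: (unliftP ord_max x) xA xm => [y ->|->]; last by rewrite eqxx.
  by move=> yA _; exists y; rewrite ?inE.
apply/chain_inP/orP=> [[A [cA hP hc]]|].
  have pA : lift ord_max @: (lift ord_max @^-1: A) = A :\ ord_max.
    apply/setP=> x; rewrite !inE; apply/imsetP/andP=> [[y + ->]|[xm xA]].
      by rewrite inE eq_sym neq_lift.
    by have [y -> yA] := liftm A x xA xm; exists y.
  have card_pA : #|lift ord_max @^-1: A| = #|A :\ ord_max|.
    by rewrite -pA card_imset //; exact: lift_inj.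
  have hc' : {in lift ord_max @^-1: A &, forall x y : 'I_n, x < y -> (s x < s y) = b}.
    move=> x y; rewrite !inE => xA yA xy; rewrite -(hc _ _ xA yA) ?liftmE //.
    by rewrite !extend_right_lift /= /bump; lia.
  have hP' : {in lift ord_max @^-1: A, forall x : 'I_n, P x (bump t (s x))}.
    by move=> x; rewrite inE => /hP; rewrite extend_right_lift liftmE.
  have [mA|mA] := boolP (ord_max \in A); [right|left].
    apply/andP; split; first by have := hP _ mA; rewrite extend_right_max.
    apply/chain_inP; exists (lift ord_max @^-1: A); split=> //.
      by rewrite card_pA; have := cardsD1 ord_max A; rewrite mA cA => -[].
    move=> x xA; rewrite hP' //=; move: xA; rewrite inE => xA.
    have := hc _ _ xA mA; rewrite liftmE extend_right_max extend_right_lift => /(_ (ltn_ord x)) <-.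
    by rewrite /= /bump; have := ltn_ord x; lia.
  apply/chain_inP; exists (lift ord_max @^-1: A); split=> //.
  by rewrite card_pA; have := cardsD1 ord_max A; rewrite (negPf mA) cA add0n.
have aux (A : {set 'I_n}) : {in A, forall x : 'I_n, P x (bump t (s x))} ->
   {in A &, forall x y : 'I_n, x < y -> (s x < s y) = b} ->
   [/\ {in lift ord_max @: A, forall x : 'I_n.+1, P x (extend_right t s x)} &
     {in lift ord_max @: A &, forall x y : 'I_n.+1,
        x < y -> (extend_right t s x < extend_right t s y) = b}].
  move=> hP hc; split.
    by move=> _ /imsetP[x xA ->]; rewrite extend_right_lift liftmE; apply: hP.
  move=> _ _ /imsetP[x xA ->] /imsetP[y yA ->]; rewrite !liftmE !extend_right_lift => xy.
  by rewrite -(hc _ _ xA yA xy) /= /bump; lia.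
case=> [/chain_inP[A [cA hP hc]]|/andP[Pt /chain_inP[A [cA hP hc]]]].
  have [hP' hc'] := aux A hP hc.
  by exists (lift ord_max @: A); split=> //; rewrite card_imset //; exact: lift_inj.
have [] := aux A _ hc; first by move=> x /hP/andP[].
move=> hP' hc'; exists (ord_max |: lift ord_max @: A); split.
- rewrite cardsU1 card_imset; last exact: lift_inj.
  rewrite cA; case: imsetP => // -[x _ /eqP].
  by rewrite (negPf (neq_lift _ _)).
- by move=> x /setU1P[->|/hP' //]; rewrite extend_right_max.
- move=> x y /setU1P[->|xA] /setU1P[->|yA]; first by rewrite ltnn.
  + by move=> /=; have := ltn_ord y; lia.
  + move=> _; move/imsetP: xA => [z zA ->]; rewrite extend_right_max extend_right_lift.
    by have /andP[_ /eqP <-] := hP z zA; rewrite /= /bump; lia.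
  + exact: hc'.
Qed.

Lemma extend_right_inj n (t : 'I_n.+1) : injective (@extend_right n t).
Proof.
move=> s s' eqs; apply/permP=> x; apply: (@lift_inj _ t).
by rewrite -!extend_right_lift eqs.
Qed.

(** Surjectivity comes for free from (n+1)! = (n+1) n!. *)
Lemma extend_right_bij n :
  bijective (fun p : 'I_n.+1 * 'S_n => extend_right p.1 p.2).
Proof.
apply: inj_card_bij => [[t s] [t' s'] /= eqs|].
  have ett : t = t' by rewrite -(extend_right_max t s) eqs extend_right_max.
  by rewrite -ett in eqs *; rewrite (extend_right_inj eqs).
by rewrite card_prod card_ord !card_Sn factS.
Qed.

Lemma extend_rightP n (s : 'S_n.+1) : exists t s', s = extend_right t s'.
Proof.
by have [g _ gK] := extend_right_bij n; exists (g s).1, (g s).2; rewrite gK.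
Qed.

(** The standardisation of s without its last entry; choosing a preimage avoids
    building that permutation by hand. *)
Definition drop_last n (s : 'S_n.+1) : 'S_n :=
  odflt 1%g [pick s' | extend_right (s ord_max) s' == s].

Lemma extend_rightK n t : cancel (@extend_right n t) (@drop_last n).
Proof.
move=> s; rewrite /drop_last; case: pickP => [s' /eqP|/(_ s)]; rewrite extend_right_max.
  by move/extend_right_inj.
by rewrite eqxx.
Qed.

Lemma sum_extend_right n (F : 'S_n.+1 -> nat) :
  \sum_s F s = \sum_(t < n.+1) \sum_(s : 'S_n) F (extend_right t s).
Proof.
rewrite pair_big (reindex (fun p : 'I_n.+1 * 'S_n => extend_right p.1 p.2)) //.
exact/onW_bij/extend_right_bij.
Qed.

(** * The first-row word of a permutation *)

Definition ones (w : seq bool) : nat := count id w.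

(** On the letters after an inserted value, this bumps the smallest larger entry
    of the first row into the second row. *)
Fixpoint clear_first (w : seq bool) : seq bool :=
  match w with
  | [::] => [::]
  | true :: w' => false :: w'
  | false :: w' => false :: clear_first w'
  end.

Definition insert_at (t : nat) (w : seq bool) : seq bool :=
  take t w ++ true :: clear_first (drop t w).

(** A tail with no 10: every entry in it that has been bumped is smaller than
    the entries of the tail still in the first row. *)
Definition ascending (w : seq bool) : bool := sorted implb w.

(** The first row of the Robinson-Schensted insertion tableau, as a set of
    values.  For permutations avoiding d_3 the second row is its complement. *)
Fixpoint word n : 'S_n -> seq bool :=
  match n with
  | 0 => fun _ => [::]
  | n'.+1 => fun s => insert_at (s ord_max) (word (drop_last s))
  end.

Lemma word_extend n (t : 'I_n.+1) (s : 'S_n) :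
  word (extend_right t s) = insert_at t (word s).
Proof. by rewrite /= extend_right_max extend_rightK. Qed.

Arguments word : simpl never.

Lemma size_clear_first w : size (clear_first w) = size w.
Proof. by elim: w => [|[] w IHw] //=; rewrite IHw. Qed.

Lemma size_insert_at t w : size (insert_at t w) = (size w).+1.
Proof.
by rewrite -[in RHS](cat_take_drop t w) !size_cat /= size_clear_first addnS.
Qed.

Lemma size_word n (s : 'S_n) : size (word s) = n.
Proof. by elim: n s => [|n IHn] s //; rewrite [word s]/= size_insert_at IHn. Qed.

Lemma ones_cat u w : ones (u ++ w) = ones u + ones w.
Proof. exact: count_cat. Qed.

Lemma ones_nseq i b : ones (nseq i b) = b * i.
Proof. exact: count_nseq. Qed.

Lemma ones_take_clear_first j w :
  ones (take j (clear_first w)) = (ones (take j w)).-1.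
Proof. by elim: w j => [|[] w IHw] [|j] //=; rewrite IHw. Qed.

Lemma ones_take_insert_low t v w : t <= size w -> v <= t ->
  ones (take v (insert_at t w)) = ones (take v w).
Proof.
move=> tw vt; rewrite take_cat size_takel //.
case: ltngtP vt => // [vt _|-> _]; last by rewrite subnn take0 cats0.
by rewrite take_takel // ltnW.
Qed.

(** An increasing sequence below v + 1 in the extended permutation either avoids
    the new last value t or is one below t followed by t. *)
Lemma ones_take_insert_high t v w : t <= size w -> t <= v ->
  ones (take v.+1 (insert_at t w)) = maxn (ones (take v w)) (ones (take t w)).+1.
Proof.
move=> tw tv; rewrite take_cat size_takel // ltnNge leqW //= subSn // take_cons ones_cat.
rewrite [ones (_ :: _)]/= -/(ones _) ones_take_clear_first.
have -> : take v w = take t w ++ take (v - t) (drop t w) by rewrite -takeD subnKC.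
by rewrite ones_cat; lia.
Qed.

(** Schensted's theorem, refined by an upper bound on the values; it
    holds for every permutation, since both sides obey the same recursion. *)
Lemma chain_inc_word n (s : 'S_n) m v : v <= n ->
  chain_in true s m (fun _ u => u < v) = (m <= ones (take v (word s))).
Proof.
elim: n s m v => [|n IHn] s [|m] v; rewrite ?chain_in0 ?chain_in_S0 // => vn.
have [t [s' ->]] := extend_rightP s; rewrite chain_in_extend word_extend.
have tn : t <= size (word s') by rewrite size_word -ltnS.
have [vt|tv] := leqP v t.
  rewrite ones_take_insert_low // -IHn; last exact: leq_trans vt (ltn_ord t).
  by rewrite andFb orbF; apply: eq_chain_in => x u _ _; rewrite /bump; lia.
case: v tv vn => // v tv vn; rewrite ones_take_insert_high // leq_max ltnS andTb.
rewrite -!IHn //; last by rewrite -ltnS.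
by congr (_ || _); apply: eq_chain_in => x u _ _; rewrite /bump; lia.
Qed.

Lemma ascendingP w : reflect (exists i j, w = nseq i false ++ nseq j true) (ascending w).
Proof.
apply: (iffP idP) => [|[i [j ->]]]; last first.
  case: i => [|i]; first by case: j => // j; rewrite /ascending /=; elim: j.
  by rewrite /ascending /=; elim: i => //= ; case: j => //= j; elim: j.
elim: w => [_|[] w IHw]; first by exists 0, 0.
- move=> tw; exists 0, (size w).+1; rewrite /=; congr (_ :: _).
  rewrite /ascending /= in tw; by elim: w tw {IHw} => //= -[] //= w IHw /IHw {1}->.
- by move=> /path_sorted/IHw[i [j ->]]; exists i.+1, j.
Qed.

Lemma ascending_drop i w : ascending w -> ascending (drop i w).
Proof. exact: drop_sorted. Qed.

Lemma ascending_cat_tail u w : ascending (u ++ w) -> ascending w.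
Proof. by move=> /(ascending_drop (size u)); rewrite drop_size_cat. Qed.

Lemma ascending_clear_first w : ascending w -> ascending (clear_first w).
Proof.
move/ascendingP=> [i [j ->]]; apply/ascendingP; case: j => [|j].
  by exists i, 0; rewrite !cats0; elim: i => //= i ->.
by exists i.+1, j; elim: i => //= i ->.
Qed.

Lemma head_clear_first b w : ascending w -> w != [::] -> head b (clear_first w) = false.
Proof. by case: w => [|[] w]. Qed.

Lemma ascending_rcons w b : ascending (rcons w b) = ascending w && (last false w ==> b).
Proof. by case: w => [|a w] //=; rewrite /ascending /= rcons_path. Qed.

Lemma contains_dec3_extend n (t : 'I_n.+1) (s : 'S_n) :
  contains_dec 3 (extend_right t s) =
    contains_dec 3 s || chain_in false s 2 (fun _ u => t <= u).
Proof.
rewrite !contains_decE chain_in_extend; congr (_ || _).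
by apply: eq_chain_in => x u _ _; lia.
Qed.

(** The pattern 10 in the word records an inversion of s.  The hypothesis on d_3
    keeps the bumped entries increasing: a value inserted last and below some
    other value is then the largest lower end of an inversion. *)
Lemma chain_dec2_word n (s : 'S_n) v : ~~ contains_dec 3 s -> v <= n ->
  chain_in false s 2 (fun _ u => v <= u) = ~~ ascending (drop v (word s)).
Proof.
elim: n s v => [|n IHn] s v; first by rewrite chain_in_S0.
have [t [s' ->]] := extend_rightP s; rewrite contains_dec3_extend negb_or.
have tn : t <= n by rewrite -ltnS.
case/andP=> s'P; rewrite IHn // negbK => wt vn; rewrite chain_in_extend word_extend.
have szt : size (take t (word s')) = t by rewrite size_takel ?size_word.
have [vt|tv] := leqP v t; last first.
  rewrite andFb orbF; case: v tv vn => // v tv vn.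
  transitivity (chain_in false s' 2 (fun _ u => v <= u)).
    by apply: eq_chain_in => x u _ _; rewrite /bump; lia.
  have wv : ascending (drop v (word s')) by rewrite -(subnK (tv : t <= v)) -drop_drop ascending_drop.
  rewrite IHn // wv drop_cat szt ltnNge leqW //= subSn //=.
  by rewrite ascending_drop // ascending_clear_first.
rewrite andTb.
have -> : chain_in false s' 1 (fun _ u => (v <= bump t u) && ((u < t) == false)) = (t < n).
  by rewrite -(chain_in1 false s' t); apply: eq_chain_in => x u _ _; rewrite /bump; lia.
have -> : chain_in false s' 2 (fun _ u => v <= bump t u) = ~~ ascending (drop v (word s')).
  rewrite -IHn //; last exact: leq_trans vt tn.
  by apply: eq_chain_in => x u _ _; rewrite /bump; lia.
have -> : drop v (insert_at t (word s')) = drop v (take t (word s')) ++ true :: clear_first (drop t (word s')).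
  rewrite drop_cat szt; case: ltngtP vt => // -> _.
  by rewrite subnn drop0 [drop t (take _ _)]drop_oversize ?szt.
case: (ltngtP t n) tn => // [ltn _|etn _].
  rewrite orbT; symmetry; apply/negP=> /ascending_cat_tail.
  have := head_clear_first true wt; rewrite -size_eq0 size_drop size_word subn_eq0 -ltnNge.
  by move=> /(_ ltn); case: (clear_first _) => //= -[].
rewrite etn [drop n _]drop_oversize ?take_oversize ?size_word // orbF cats1 ascending_rcons.
by rewrite implybT andbT.
Qed.

(** A new last value t completes a d_3 exactly below an inversion whose values
    are both at least t. *)
Lemma avoid_dec3_extend n (t : 'I_n.+1) (s : 'S_n) :
  ~~ contains_dec 3 (extend_right t s) =
    ~~ contains_dec 3 s && ascending (drop t (word s)).
Proof.
rewrite contains_dec3_extend negb_or; case: (boolP (contains_dec 3 s)) => //= sP.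
by rewrite chain_dec2_word // ?negbK // -ltnS.
Qed.

(** * Ballot words and the two parents of a word *)

(** The lattice-word condition, written with the length of each prefix so that
    only true letters are counted. *)
Definition ballot (w : seq bool) : bool :=
  all (fun i => i <= (ones (take i w)).*2) (iota 0 (size w).+1).

Lemma ballot_rcons w b :
  ballot (rcons w b) = ballot w && (size w < (ones (rcons w b)).*2).
Proof.
rewrite /ballot size_rcons -[in LHS]addn1 iotaD all_cat /= andbT add0n.
rewrite -[X in take X (rcons w b)](size_rcons w b) take_size; congr (_ && _).
apply: eq_in_all => i; rewrite mem_iota => /andP[_ iw].
by rewrite -cats1 takel_cat.
Qed.

Lemma ballot_size w : ballot w -> size w <= (ones w).*2.
Proof.
by move/allP/(_ (size w)); rewrite take_size; apply; rewrite mem_iota leqnn.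
Qed.

Lemma nseqSr T n (x : T) : nseq n.+1 x = rcons (nseq n x) x.
Proof. by rewrite -cats1 cat_nseq; elim: n => //= n ->. Qed.

Lemma ballot_cat_ones w j : ballot (w ++ nseq j true) = ballot w.
Proof.
elim: j => [|j IHj]; first by rewrite cats0.
rewrite nseqSr -rcons_cat ballot_rcons IHj; case: (boolP (ballot w)) => //= bw.
have := ballot_size bw.
rewrite -cats1 !ones_cat !ones_nseq /= size_cat size_nseq; lia.
Qed.

Lemma ballot_cat_zeros w i :
  ballot (w ++ nseq i false) = ballot w && (size w + i <= (ones w).*2).
Proof.
elim: i => [|i IHi].
  by rewrite cats0 addn0; case: (boolP (ballot w)) => // /ballot_size ->.
rewrite nseqSr -rcons_cat ballot_rcons IHi -cats1 !ones_cat !ones_nseq.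
rewrite size_cat size_nseq; case: (ballot w) => //=; lia.
Qed.

Lemma ballot_ones_zeros_ones w i j :
  ballot (w ++ nseq i false ++ nseq j true) =
    ballot w && (size w + i <= (ones w).*2).
Proof. by rewrite catA ballot_cat_ones ballot_cat_zeros. Qed.

Lemma ballot_rcons_true w : ballot (rcons w true) = ballot w.
Proof. by rewrite -cats1 -(ballot_cat_ones w 1). Qed.

(** Splitting off the maximal final run of a letter; this is how the parents of
    a word are located. *)
Lemma last_run b w : exists y j, w = y ++ nseq j b /\
  (y = [::] \/ exists y', y = rcons y' (~~ b)).
Proof.
elim/last_ind: w => [|w a [y [j [-> hy]]]]; first by exists [::], 0; split=> //; left.
have [->|ab] := eqVneq a b; first by exists y, j.+1; rewrite nseqSr rcons_cat.
exists (rcons (y ++ nseq j b) a), 0; rewrite cats0; split=> //; right.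
by exists (y ++ nseq j b); congr rcons; case: (a) (b) ab => -[].
Qed.

Lemma nseq_run_inj b i i' u u' :
  nseq i b ++ ~~ b :: u = nseq i' b ++ ~~ b :: u' -> i = i' /\ u = u'.
Proof.
elim: i i' => [|i IHi] [|i'] //=; first by case.
- by case; case: b.
- by case; case: b {IHi}.
- by case=> /IHi[-> ->].
Qed.

(** The final run is determined by the word, which gives the uniqueness of
    parents. *)
Lemma cat_run_inj b i i' u u' :
  rcons u (~~ b) ++ nseq i b = rcons u' (~~ b) ++ nseq i' b -> u = u' /\ i = i'.
Proof.
move/(congr1 rev); rewrite !rev_cat !rev_nseq !rev_rcons.
by move/nseq_run_inj=> [-> /(congr1 rev)]; rewrite !revK.
Qed.

(** A row step: no first-row entry exceeds the inserted value. *)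
Lemma insert_at_zeros x i :
  insert_at (size x) (x ++ nseq i false) = rcons x true ++ nseq i false.
Proof.
rewrite /insert_at take_size_cat // drop_size_cat // cat_rcons.
by congr (_ ++ _ :: _); elim: i => //= i ->.
Qed.

(** A bumping step.  Since everything after the bumped entry is in the first
    row, the block 0^i 1^(j+1) becomes 1 0^(i+1) 1^j. *)
Lemma insert_at_zeros_ones x i j :
  insert_at (size x) (x ++ nseq i false ++ nseq j.+1 true) =
    rcons x true ++ nseq i.+1 false ++ nseq j true.
Proof.
rewrite /insert_at take_size_cat // drop_size_cat // cat_rcons.
by congr (_ ++ _ :: _); elim: i => //= i ->.
Qed.

Lemma ascending_drop_split t w : t <= size w -> ascending (drop t w) ->
  exists x i j, w = x ++ nseq i false ++ nseq j true /\ t = size x.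
Proof.
move=> tw /ascendingP[i [j def_w]]; exists (take t w), i, j.
by rewrite size_takel // -def_w cat_take_drop.
Qed.

(** Inverse insertion along a row step: position and parent can be read off from
    the last true letter. *)
Lemma insert_rowE t w x i : t <= size w ->
  [&& ascending (drop t w), insert_at t w == rcons x true ++ nseq i false &
      ones w != ones (insert_at t w)] =
    (t == size x) && (w == x ++ nseq i false).
Proof.
move=> tw; apply/and3P/andP=> [[tP /eqP + nw]|[/eqP-> /eqP->]].
  have [y [i' [j [defw deft]]]] := ascending_drop_split tw tP.
  rewrite {}defw {}deft {tw tP} in nw *.
  case: j nw => [_|j]; last first.
    rewrite insert_at_zeros_ones !ones_cat !ones_nseq -cats1 ones_cat /=.
    by move/eqP; lia.
  by rewrite cats0 insert_at_zeros => /cat_run_inj[-> ->].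
rewrite insert_at_zeros drop_size_cat // !eqxx -cats1 !ones_cat !ones_nseq /=; split=> //.
  by apply/ascendingP; exists i, 0; rewrite cats0.
lia.
Qed.

(** Inverse insertion along a bumping step: position and parent can be read off
    from the last false run and the true letter in front of it. *)
Lemma insert_bumpE t w x i j : t <= size w ->
  [&& ascending (drop t w), insert_at t w == rcons x true ++ nseq i.+1 false ++ nseq j true &
      ones w == ones (insert_at t w)] =
    (t == size x) && (w == x ++ nseq i false ++ nseq j.+1 true).
Proof.
move=> tw; apply/and3P/andP=> [[tP /eqP + nw]|[/eqP-> /eqP->]].
  have [y [i' [j' [defw deft]]]] := ascending_drop_split tw tP.
  rewrite {}defw {}deft {tw tP} in nw *.
  case: j' nw => [|j' _].
    rewrite cats0 insert_at_zeros !ones_cat !ones_nseq -cats1 ones_cat /=.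
    by move/eqP; lia.
  rewrite insert_at_zeros_ones !nseqSr !catA -!rcons_cat => /cat_run_inj[+ ->].
  by move=> /cat_run_inj[-> ->].
rewrite insert_at_zeros_ones drop_size_cat // !eqxx -cats1 !ones_cat !ones_nseq /=; split=> //.
  by apply/ascendingP; exists i, j.+1.
lia.
Qed.

Lemma ballot_word n (s : 'S_n) : ~~ contains_dec 3 s -> ballot (word s).
Proof.
elim: n s => [//|n IHn] s; have [t [s' ->]] := extend_rightP s.
rewrite avoid_dec3_extend word_extend => /andP[/IHn bw /ascending_drop_split].
rewrite size_word -ltnS => /(_ (ltn_ord t))[x [i [j [defw ->]]]].
rewrite {}defw in bw *; move: bw.
case: j => [|j]; last first.
  rewrite insert_at_zeros_ones !ballot_ones_zeros_ones ballot_rcons_true.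
  by case/andP=> -> /=; rewrite size_rcons -cats1 ones_cat /=; lia.
rewrite cats0 insert_at_zeros !ballot_cat_zeros ballot_rcons_true.
by case/andP=> -> /=; rewrite size_rcons -cats1 ones_cat /=; lia.
Qed.

(** * Counting permutations with a given word *)

Definition fiber n (w : seq bool) : nat :=
  #|[set s : 'S_n | ~~ contains_dec 3 s && (word s == w)]|.

(** The last insertion bumps exactly when the first row does not grow. *)
Definition bumping n (s : 'S_n.+1) : bool :=
  ones (word (drop_last s)) == ones (word s).

Lemma card_set_sum (T : finType) (Q : pred T) : #|[set s | Q s]| = \sum_s Q s.
Proof. by rewrite -sum1_card big_mkcond; apply: eq_bigr => s _; rewrite inE; case: (Q s). Qed.

Lemma card_one_parent n (Q : pred 'S_n.+1) t0 w :
  t0 <= n ->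
  (forall t s, Q (extend_right t s) =
     ~~ contains_dec 3 s && ((t == t0 :> nat) && (word s == w))) ->
  #|[set s | Q s]| = fiber n w.
Proof.
move=> t0n defQ; rewrite /fiber !card_set_sum sum_extend_right.
rewrite (bigD1 (Ordinal (t0n : t0 < n.+1))) //= [X in _ + X]big1 => [|t /negPf nt].
  by rewrite addn0; apply: eq_bigr => s _; rewrite defQ eqxx.
apply: big1 => s _; rewrite defQ.
by move: nt; rewrite -val_eqE /= => ->; rewrite andbF.
Qed.

Lemma fiber_split n w :
  fiber n.+1 w =
    #|[set s : 'S_n.+1 | [&& ~~ contains_dec 3 s, word s == w & ~~ bumping s]]| +
    #|[set s : 'S_n.+1 | [&& ~~ contains_dec 3 s, word s == w & bumping s]]|.
Proof.
rewrite /fiber !card_set_sum -big_split; apply: eq_bigr => s _ /=.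
by case: contains_dec; case: eqP; case: bumping.
Qed.

Lemma bumping_extend n (t : 'I_n.+1) (s : 'S_n) :
  bumping (extend_right t s) = (ones (word s) == ones (insert_at t (word s))).
Proof. by rewrite /bumping extend_rightK word_extend. Qed.

(** The parent of w by a row step need not be ballot; it is so exactly when its
    number of false letters does not exceed the number of true ones, that is,
    when removing the end of the first row leaves a partition shape. *)
Lemma card_row_steps n w : ballot w -> size w = n.+1 ->
  exists w', [/\ size w' = n, (ones w').+1 = ones w,
    ballot w' = (n <= (ones w').*2) &
    #|[set s : 'S_n.+1 | [&& ~~ contains_dec 3 s, word s == w & ~~ bumping s]]|
      = fiber n w'].
Proof.
move=> + szw; have [y [i [defw yP]]] := last_run false w.
case: yP defw => [->|[x ->]] defw bw.
  by have := ballot_size bw; rewrite szw defw ones_nseq mul0n.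
exists (x ++ nseq i false).
have szx : size x + i = n by move: szw; rewrite defw size_cat size_rcons size_nseq; lia.
rewrite defw !ones_cat !ones_nseq -[in ones (rcons _ _)]cats1 ones_cat size_cat size_nseq /=.
split=> //; first by lia.
  rewrite ballot_cat_zeros szx.
  by move: bw; rewrite defw ballot_cat_zeros ballot_rcons_true => /andP[-> _]; rewrite mul0n addn0.
apply: (@card_one_parent _ _ (size x)) => [|t s]; first by lia.
rewrite avoid_dec3_extend bumping_extend word_extend -andbA insert_rowE //.
by rewrite size_word -ltnS.
Qed.

(** Unlike for row steps, the parent of a ballot word by a bumping step is always
    ballot: shortening the second row cannot spoil the shape. *)
Lemma card_bump_steps n w : ballot w -> size w = n.+1 -> ones w <= n ->
  exists w', [/\ size w' = n, ones w' = ones w, ballot w' &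
    #|[set s : 'S_n.+1 | [&& ~~ contains_dec 3 s, word s == w & bumping s]]|
      = fiber n w'].
Proof.
move=> + szw; have [y [j [defw yP]]] := last_run true w.
case: yP defw => [->|[z ->]] defw bw wn.
  by move: wn; rewrite defw in szw *; rewrite size_nseq in szw; rewrite ones_nseq; lia.
have [y' [i [defz yP]]] := last_run false z.
have {}defw : w = y' ++ nseq i.+1 false ++ nseq j true.
  by rewrite defw defz nseqSr catA rcons_cat.
case: yP defw {defz} => [->|[x ->]] defw.
  by move: bw; rewrite defw cat0s ballot_cat_ones -[nseq _ _]cat0s ballot_cat_zeros.
exists (x ++ nseq i false ++ nseq j.+1 true).
have szx : size x + i + j = n.-1 /\ 0 < n.
  by move: szw; rewrite defw !size_cat size_rcons !size_nseq; lia.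
split.
- by rewrite !size_cat !size_nseq; lia.
- by rewrite defw -cats1 !ones_cat !ones_nseq /=; lia.
- move: bw; rewrite defw !ballot_ones_zeros_ones ballot_rcons_true => /andP[-> /=].
  by rewrite -cats1 !ones_cat size_cat /=; lia.
apply: (@card_one_parent _ _ (size x)) => [|t s]; first by lia.
rewrite avoid_dec3_extend bumping_extend word_extend defw -andbA insert_bumpE //.
by rewrite size_word -ltnS.
Qed.

(** By the reflection principle, the number of ballot words of length n with r
    true letters; truncated subtraction makes it vanish for n > 2r, as it
    should. *)
Definition ballot_number n r : nat := 'C(n, r) - 'C(n, r.+1).

Lemma bin_antitone n r : n <= r.*2.+1 -> 'C(n, r.+1) <= 'C(n, r).
Proof. by move=> nr; have := mul_bin_left n r; nia. Qed.

Lemma ballot_number_eq0 n r : r.*2 < n -> ballot_number n r = 0.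
Proof.
move=> rn; apply/eqP; rewrite subn_eq0; have := mul_bin_left n r; nia.
Qed.

Lemma ballot_numberS n r : n <= r.*2.+1 ->
  ballot_number n.+1 r.+1 = ballot_number n r + ballot_number n r.+1.
Proof.
move=> nr; have := bin_antitone nr; have := @bin_antitone n r.+1.
by rewrite /ballot_number !binS; lia.
Qed.

(** The number of recording tableaux does not depend on the insertion tableau
    but only on its shape: the two kinds of last step give the two terms of the
    Pascal-like rule [ballot_numberS]. *)
Lemma card_fiber n w : ballot w -> size w = n -> fiber n w = ballot_number n (ones w).
Proof.
elim: n w => [|n IHn] w bw szw.
  rewrite (size0nil szw) /fiber card_set_sum (big_pred1 1%g) => [|s].
    rewrite contains_decE; case: chain_inP => // -[A [cA _ _]].
    by have := max_card (mem A); rewrite cA card_ord.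
  by symmetry; apply/eqP/permP=> -[].
have [wr [szr wr_ones wr_ballot cr]] := card_row_steps bw szw.
have nw := ballot_size bw; rewrite fiber_split cr -wr_ones ballot_numberS; last by lia.
congr (_ + _).
  (* When the parent is not ballot, its fiber is empty and the corresponding
     ballot number vanishes as well. *)
  have [nr|rn] := leqP n (ones wr).*2; first by rewrite IHn // wr_ballot.
  rewrite ballot_number_eq0 //; apply: eq_card0 => s; rewrite inE.
  apply/negP=> /andP[/ballot_word + /eqP ws].
  by rewrite ws wr_ballot leqNgt rn.
rewrite wr_ones; have [wn|nlt] := leqP (ones w) n.
  by have [w' [sz' <- b' ->]] := card_bump_steps bw szw wn; apply: IHn.
(* A word of true letters only has no parent by bumping. *)
rewrite /ballot_number !bin_small ?subn0 //; last exact: ltnW.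
apply: eq_card0 => s; rewrite inE; apply/negP=> /and3P[_ /eqP ws].
rewrite /bumping ws => /eqP eqo.
have := count_size id (word (drop_last s)); rewrite size_word -/(ones _) eqo.
lia.
Qed.

Lemma sum_rcons_tuple n (F : seq bool -> nat) :
  \sum_(w : n.+1.-tuple bool) F w =
    \sum_(w : n.-tuple bool) (F (rcons w true) + F (rcons w false)).
Proof.
pose h (p : n.-tuple bool * bool) := [tuple of rcons p.1 p.2].
have h_bij : bijective h.
  apply: inj_card_bij => [[u b] [u' b'] /(congr1 val)/= /rcons_inj[/val_inj -> ->] //|].
  by rewrite card_prod !card_tuple card_bool expnSr.
rewrite (reindex h); last exact/onW_bij.
rewrite -(pair_big xpredT xpredT (fun (u : n.-tuple bool) b => F (rcons u b))) /=.
by apply: eq_bigr => u _; rewrite big_bool.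
Qed.

Lemma card_ballot_tuples n r :
  #|[set w : n.-tuple bool | ballot w && (ones w == r)]| = ballot_number n r.
Proof.
elim: n r => [|n IHn] r.
  rewrite card_set_sum (eq_bigr (fun _ => (r == 0) : nat)) => [|w _].
    by rewrite sum_nat_const card_tuple mul1n /ballot_number !bin0n subn0.
  by rewrite (tuple0 w) /= eq_sym.
have [nr|rn] := leqP n.+1 r.*2; last first.
  rewrite ballot_number_eq0 //; apply: eq_card0 => w; rewrite inE.
  apply/negP=> /andP[/ballot_size]; rewrite size_tuple => + /eqP wr.
  by rewrite wr leqNgt rn.
case: r nr => // r nr; rewrite ballot_numberS; last by lia.
rewrite card_set_sum (sum_rcons_tuple _ (fun w => (ballot w && (ones w == r.+1)) : nat)).
rewrite big_split -!IHn !card_set_sum; congr (_ + _); apply: eq_bigr => w _.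
  rewrite ballot_rcons size_tuple -cats1 ones_cat /= addn1 eqSS.
  case: eqP => [->|]; rewrite ?andbF // ?andbT.
  by rewrite (_ : n < _) ?andbT //; lia.
rewrite ballot_rcons size_tuple -cats1 ones_cat /= !addn0.
case: eqP => [->|]; rewrite ?andbF // ?andbT.
by rewrite (_ : n < _) ?andbT //; lia.
Qed.

(** * Crucial permutations in terms of words *)

Lemma contains_inc_word m n (s : 'S_n) : contains_inc m s = (m <= ones (word s)).
Proof.
rewrite contains_incE -[X in ones X](take_size) size_word -chain_inc_word //.
by apply: eq_chain_in => x v _ ->.
Qed.

Lemma contains_inc_or_decV k l n (s : 'S_n) :
  contains_inc_or_dec k l (s^-1)%g = contains_inc_or_dec k l s.
Proof. by rewrite /contains_inc_or_dec !contains_incE !contains_decE !chain_inV. Qed.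

Lemma extend_aboveE n (t : 'I_n.+1) (s : 'S_n) :
  extend_above t s = ((extend_right t s^-1)^-1)%g.
Proof. by rewrite /extend_right lift_permV invgK. Qed.

Lemma ascending_last_false w : ascending w -> ~~ last false w -> ones w = 0.
Proof.
case/ascendingP=> i [[|j] ->]; first by rewrite cats0 ones_nseq.
by rewrite nseqSr -rcons_cat last_rcons.
Qed.

(** Appending t gives i_(r+1) when r true letters precede position t, and d_3
    when a 10 occurs from position t on.  If the word has r true letters and
    ends in false, every t falls under one of the two.  If it ends in true,
    inserting just before that letter gives neither, and if it has fewer than r
    true letters, inserting at the very end gives neither. *)
Lemma right_crucialE r n (s : 'S_n.+1) : 0 < r ->
  ~~ contains_inc_or_dec r.+1 3 s ->
  [forall t, contains_inc_or_dec r.+1 3 (extend_right t s)] =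
    chain_in true s r (fun _ v => v < n).
Proof.
move=> r_gt0; rewrite negb_or => /andP[incs decs]; rewrite chain_inc_word //.
have extE t : contains_inc_or_dec r.+1 3 (extend_right t s) =
    (r <= ones (take t (word s))) || ~~ ascending (drop t (word s)).
  have tn : t <= n.+1 by rewrite -ltnS.
  rewrite /contains_inc_or_dec -[contains_dec _ _]negbK avoid_dec3_extend decs /=.
  congr (_ || _); rewrite contains_incE chain_in_extend -chain_inc_word //=.
  rewrite -contains_incE (negPf incs) /=; apply: eq_chain_in => x v _ _.
  by rewrite eqb_id.
rewrite contains_inc_word -ltnNge ltnS in incs.
case: (lastP (word s)) (size_word s) incs extE => [//|u b].
rewrite size_rcons => -[szu] incs extE.
have takeE v : v <= n -> take v (rcons u b) = take v u.
  by move=> vn; rewrite -cats1 takel_cat // szu.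
rewrite takeE // -[X in take X u]szu take_size.
apply/forallP/idP=> [/(_ (inord n))|ru t]; rewrite extE.
  rewrite inordK // takeE // -[X in take X u]szu take_size.
  by case: leqP => //= _ /negP[]; rewrite -cats1 -szu drop_size_cat.
case: leqP => //= tr; have [nt|tn] := ltnP n t.
  rewrite take_oversize ?size_rcons ?szu // in tr.
  by rewrite -cats1 ones_cat in tr; lia.
rewrite takeE // in tr; rewrite drop_rcons ?szu // ascending_rcons.
rewrite -(cat_take_drop t u) ones_cat in ru.
have {incs} b0 : b = false.
  by rewrite -cats1 -(cat_take_drop t u) !ones_cat in incs; case: b incs {extE takeE} => //=; lia.
rewrite b0 implybF; apply/negP=> /andP[/ascending_last_false ones0] /ones0 dt0.
by rewrite dt0 in ru; lia.
Qed.

(** The last two conditions say that removing the largest value, respectively the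
    last position, does not destroy all increasing subsequences of length r. *)
Lemma top_right_crucialE r n (s : 'S_n.+1) : 0 < r ->
  top_right_crucial r.+1 3 s =
    [&& ~~ contains_dec 3 s, ones (word s) <= r,
        r <= ones (take n (word s)) & r <= ones (word (drop_last s))].
Proof.
move=> r_gt0; rewrite /top_right_crucial.
case: (boolP (contains_inc_or_dec r.+1 3 s)) => [|avs] /=.
  by rewrite /contains_inc_or_dec contains_inc_word ltnNge; case: (leqP (ones _) r); case: contains_dec.
have := avs; rewrite negb_or contains_inc_word -ltnNge ltnS => /andP[-> ->] /=.
have -> : [forall t, contains_inc_or_dec r.+1 3 (extend_above t s)] =
    [forall t, contains_inc_or_dec r.+1 3 (extend_right t s^-1)].
  by apply: eq_forallb => t; rewrite extend_aboveE contains_inc_or_decV.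
rewrite !right_crucialE ?contains_inc_or_decV // chain_inc_word //; congr (_ && _).
rewrite chain_inV; have [t [s' ->]] := extend_rightP s; rewrite extend_rightK.
case: r r_gt0 {avs} => // r _; rewrite chain_in_extend ltnn orbF -contains_inc_word.
by rewrite contains_incE; apply: eq_chain_in => x v ->.
Qed.

(** * The number of crucial permutations *)

Lemma ones_word_drop_last n (s : 'S_n.+1) : ones (word (drop_last s)) <= ones (word s).
Proof.
have [t [s' ->]] := extend_rightP s; rewrite extend_rightK word_extend.
have tn : t <= size (word s') by rewrite size_word -ltnS.
rewrite -[X in _ <= ones X]take_size size_insert_at ones_take_insert_high //.
by rewrite take_size leq_maxl.
Qed.

Lemma num_top_right_crucial0 k l : 1 < k -> num_top_right_crucial 0 k.+1 l.+2 = 0.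
Proof.
move=> k_gt1; apply: eq_card0 => s; rewrite inE; apply/negP=> /and3P[_ /forallP/(_ ord0)].
have noS (m : nat) (u : 'S_1) b P : 1 < m -> chain_in b u m P = false.
  move=> m1; apply/chain_inP=> -[A [cA _ _]].
  by have := max_card (mem A); rewrite cA card_ord; lia.
by rewrite /contains_inc_or_dec contains_incE contains_decE !noS //; lia.
Qed.

(** A crucial permutation has word u0 with u ballot with r true letters, and its
    last step bumps.  Summing over u, each contributes the fiber of the unique
    bumping parent of u0, whose size does not depend on u. *)
Lemma num_top_right_crucial3 r n : 0 < r ->
  num_top_right_crucial n.+1 r.+1 3 = if n < r.*2 then ballot_number n r ^ 2 else 0.
Proof.
move=> r_gt0; case: ltnP => nr; last first.
  apply: eq_card0 => s; rewrite inE top_right_crucialE //; apply/negP.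
  case/and4P=> /ballot_word/ballot_size; rewrite size_word; lia.
pose steps (w : n.-tuple bool) := [set s : 'S_n.+1 |
  [&& ~~ contains_dec 3 s, word s == rcons w false & bumping s]].
pose good (w : seq bool) := ballot w && (ones w == r).
(* [w] is the word of the permutation without its final false letter. *)
transitivity (\sum_(w : n.-tuple bool | good w) #|steps w|); last first.
  rewrite -mulnn -[X in X * _](card_ballot_tuples n r) -sum_nat_const.
  apply: congr_big => // [w|w /andP[bw /eqP wr]]; first by rewrite inE.
  have cw : ones (rcons w false) = r by rewrite -cats1 ones_cat addn0.
  have bw' : ballot (rcons w false) by rewrite ballot_rcons bw cw size_tuple.
  have szw : size (rcons w false) = n.+1 by rewrite size_rcons size_tuple.
  have cn : ones (rcons w false) <= n.
    by rewrite cw -wr -[leqRHS](size_tuple w) count_size.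
  have [w' [szw' ow' bw'' ->]] := card_bump_steps bw' szw cn.
  by rewrite card_fiber // ow' cw.
rewrite /num_top_right_crucial card_set_sum.
under [RHS]eq_bigr do rewrite card_set_sum.
rewrite exchange_big; apply: eq_bigr => s _ /=.
rewrite top_right_crucialE // /bumping.
case: (boolP (contains_dec 3 s)) => [_|/ballot_word ballot_s] /=; first by rewrite big1.
have := ones_word_drop_last s; move: (ones (word (drop_last s))) => d.
case: (lastP (word s)) (size_word s) ballot_s => [//|u b].
rewrite size_rcons => -[szu]; rewrite ballot_rcons => /andP[bu _].
rewrite -[u in take _ u]cats1 takel_cat ?szu // -[X in take X u]szu take_size.
rewrite -cats1 ones_cat => dle.
have uP : size u == n by rewrite szu.
transitivity (good u && (~~ b && (d == r)) : nat).
  by rewrite /good bu /=; case: b dle => /= dle; lia.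
rewrite big_mkcond (bigD1 (Tuple uP)) //= big1 => [|w /negPf nw].
  rewrite addn0 cats1 eqseq_rcons eqxx /=; case: ifP => [/andP[_ /eqP ur]|_] //=.
  by case: b {dle} => //=; rewrite !addn0 ur.
rewrite cats1 eqseq_rcons.
by move: nw; rewrite -val_eqE /= eq_sym => ->; case: good.
Qed.

Lemma ballot_number_gt0 n r : r <= n -> n < r.*2 ->
  0 < ballot_number n r.
Proof.
move=> rn nr; rewrite subn_gt0; have := mul_bin_left n r.
have : 0 < 'C(n, r) by rewrite bin_gt0.
nia.
Qed.

(** So the crucial lengths are r+1, ..., 2r, and r + i is the i-th of them. *)
Lemma top_right_crucial_lengthE r n : 1 < r ->
  top_right_crucial_length r.+1 3 n = (r < n <= r.*2).
Proof.
move=> r_gt1.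
have -> : top_right_crucial_length r.+1 3 n = (0 < num_top_right_crucial n r.+1 3).
  apply/existsP/card_gt0P=> -[s sP]; exists s; first by rewrite inE.
  by rewrite inE in sP.
case: n => [|n]; first by rewrite num_top_right_crucial0.
rewrite num_top_right_crucial3 ?(ltnW r_gt1) // ltnS.
case: ifP => nr; last by rewrite ltnn; lia.
rewrite expn_gt0 orbF; have [rn|nlt] := leqP r n; first by rewrite ballot_number_gt0 ?nr.
by rewrite /ballot_number !bin_small // ltnW.
Qed.

Lemma ith_smallest_crucial_length r i : 1 < r -> 0 < i -> i <= r ->
  ith_smallest (top_right_crucial_length r.+1 3) i (r + i).
Proof.
move=> r_gt1 i_gt0 ir; rewrite /ith_smallest top_right_crucial_lengthE //.
apply/andP; split; first by lia.
have -> : r + i = r.+1 + i.-1 by lia.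
rewrite iotaD count_cat add0n.
have /eqP-> : count (top_right_crucial_length r.+1 3) (iota 0 r.+1) == 0.
  rewrite -leqn0 leqNgt -has_count; apply/hasPn=> j; rewrite mem_iota => jr.
  by rewrite top_right_crucial_lengthE //; lia.
apply/eqP; rewrite -[RHS](size_iota r.+1); apply/eqP; rewrite -all_count.
by apply/allP=> j; rewrite mem_iota => jr; rewrite top_right_crucial_lengthE //; lia.
Qed.

Import GRing.Theory.
Local Open Scope ring_scope.

(** From k C(n-1,k) = (n-k) C(n-1,k-1). *)
Lemma ballot_number_rat n k : (k < n)%N -> (n < 2 * k)%N ->
  (ballot_number n.-1 k.-1)%:R =
    (2%:R * k%:R - n%:R) / (n%:R - k%:R) * 'C(n - 1, k)%:R :> rat.
Proof.
case: k => [|k]; first by lia.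
case: n => // n kn nk; rewrite subn1 /= natrB; last by apply: bin_antitone; lia.
have /(congr1 (fun m => m%:R : rat)) := mul_bin_left n k.
rewrite !natrM natrB; last by lia.
have nz : (n.+1%:R - k.+1%:R : rat) != 0.
  by rewrite subr_eq0 Num.Theory.eqr_nat; apply/eqP; lia.
move: nz; rewrite -(natr1 n) -(natr1 k).
move: (n%:R : rat) (k%:R : rat) ('C(n, k)%:R : rat) ('C(n, k.+1)%:R : rat) => x y c c' nz e.
apply: (mulIf nz); rewrite mulrAC divfK //.
have -> : (c - c') * (x + 1 - (y + 1)) = (x - y) * c - (x - y) * c' by ring.
rewrite -e; ring.
Qed.

Theorem corollary27 (k : nat) (hk : (3 <= k)%N) :
  (forall n : nat, (k + 1 <= n)%N -> (n <= 2 * k - 2)%N ->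
     (num_top_right_crucial n k 3)%:R =
       ((2%:R * k%:R - n%:R) / (n%:R - k%:R) * 'C(n - 1, k)%:R) ^+ 2 :> rat) /\
  (forall i : nat, (2 <= i)%N -> (i <= k - 1)%N ->
     ith_smallest (top_right_crucial_length k 3) i (k + i - 1) /\
     (num_top_right_crucial (k + i - 1) k 3)%:R =
       ((k%:R - i%:R + 1) / (i%:R - 1) * 'C(k + i - 2, k)%:R) ^+ 2 :> rat) /\
  (forall i : nat, (k <= i)%N -> num_top_right_crucial (k + i - 1) k 3 = 0%N).
Proof.
have countE n : (k < n)%N -> (n <= 2 * k - 2)%N ->
    (num_top_right_crucial n k 3)%:R =
      ((2%:R * k%:R - n%:R) / (n%:R - k%:R) * 'C(n - 1, k)%:R) ^+ 2 :> rat.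
  move=> kn nk; rewrite -ballot_number_rat //; last by lia.
  rewrite -natrX; case: k hk kn nk => // r; case: n => // n r3 kn nk.
  rewrite num_top_right_crucial3; last by lia.
  by rewrite ifT //; lia.
split; first by move=> n; rewrite addn1; apply: countE.
split=> i.
  move=> i2 ik; split.
    have -> : (k + i - 1 = k.-1 + i)%N by lia.
    by case: k hk ik {countE} => // r r3 ik; apply: ith_smallest_crucial_length; lia.
  rewrite countE; [|lia|lia].
  have -> : (k + i - 1 - 1 = k + i - 2)%N by lia.
  congr ((_ / _ * _) ^+ 2); rewrite natrB ?natrD; [ring|lia|ring|lia].
move=> ki; case: k hk ki {countE} => // r r3 ri.
have -> : (r.+1 + i - 1 = (r + i).-1.+1)%N by lia.
rewrite num_top_right_crucial3; last by lia.
by rewrite ifF //; lia.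
Qed.
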